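(* Let $c$ be a superattracting parameter. Fix $N\in\mathbb{N}$ and $k\in\mathbb{N}$, and let $p_i\in\{0,1,\dots,k-1\}$ for $i=1,\dots,N$. Put $\zeta_k=e^{2\pi i/k}$ and $c_i=c+\rho\,\zeta_k^{p_i}$, where $\rho$ is a complex variable. Let $\Delta(\rho)$ be the discriminant, with respect to the variable $z$, of the polynomial equation $f_{c_N}\circ\cdots\circ f_{c_1}(z)-z=0$; it is a polynomial in $\rho$. If $\Delta(\rho_0)=0$ for some $\rho_0\in\mathbb{C}$, then $r_{\mathrm{bif}}(c)\le|\rho_0|$.
   Context: $f_c(z)=z^2+c$, extended to $\widehat{\mathbb{C}}$ by $f_c(\infty)=\infty$. A parameter $c$ is superattracting if $f_{c}^{\circ p}(0)=0$ for some $p\in\mathbb{N}$. For $c\in\mathbb{C}$, $r\ge0$, $G_{c,r}$ is the semigroup under composition generated by $\{f_{c'}:|c'-c|\le r\}$. A minimal set of a polynomial semigroup $G$ is a minimal element, with respect to inclusion, of the family of non-empty compact $L\subset\widehat{\mathbb{C}}$ with $g(L)\subset L$ for all $g\in G$; it is planar if $\infty\notin L$. The bifurcation radius $r_{\mathrm{bif}}(c)$ is the supremum of those $r\ge0$ for which $G_{c,r}$ has a planar minimal set (equivalently the infimum of those $r\ge0$ for which $G_{c,r}$ has no planar minimal set); by prior work this value is attained and $G_{c,r}$ has a planar minimal set iff $r\le r_{\mathrm{bif}}(c)$. *)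

(* Defs.v *)
From HB Require Import structures.
From mathcomp Require Import all_boot all_order all_algebra.
From mathcomp Require Import all_classical all_reals.
From mathcomp Require Import ereal topology normedtype trigo.
From mathcomp Require Import complex.
Set Implicit Arguments. Unset Strict Implicit. Unset Printing Implicit Defensive.
Import Order.TTheory GRing.Theory Num.Theory.
Import numFieldNormedType.Exports.
Local Open Scope classical_set_scope.
Local Open Scope ring_scope.
Local Open Scope complex_scope.

(* Equip C = R[i] with its canonical metric topology (from its norm). *)
HB.instance Definition _ (R : realType) :=
  PseudoPointedMetric.copy R[i] (R[i])^o.

Section Defs.
Variable R : realType.
Local Notation C := R[i].

Definition modulus (z : C) : R := @complex.Re R `|z|.

Definition fquad (c : C) (z : C) : C := z ^+ 2 + c.

Definition superattracting (c : C) : Prop :=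
  exists p : nat, (0 < p)%N /\ iter p (fquad c) 0 = 0.

Inductive semigroup_Gcr (c : C) (r : R) : (C -> C) -> Prop :=
  | Gcr_gen c' : modulus (c' - c) <= r -> semigroup_Gcr c r (fquad c')
  | Gcr_comp g h : semigroup_Gcr c r g -> semigroup_Gcr c r h ->
                   semigroup_Gcr c r (g \o h).

Definition forward_invariant (G : (C -> C) -> Prop) (L : set C) : Prop :=
  forall g, G g -> g @` L `<=` L.

Definition planar_minimal_set (G : (C -> C) -> Prop) (L : set C) : Prop :=
  [/\ L !=set0, compact L, forward_invariant G L &
      forall L' : set C, L' !=set0 -> compact L' -> forward_invariant G L' ->
        L' `<=` L -> L' = L].

Definition r_bif (c : C) : \bar R :=
  ereal_sup [set (r%:E)%E | r in [set r : R | 0 <= r /\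
     exists L, planar_minimal_set (semigroup_Gcr c r) L]].

Definition zeta (k : nat) : C := cos (2 * pi / k%:R) +i* sin (2 * pi / k%:R).

Definition disc_monic (A : comNzRingType) (P : {poly A}) : A :=
  (-1) ^+ (((size P).-1 * (size P).-2)./2) * resultant P P^`().

(* The polynomial f_{c_N} o ... o f_{c_1}(z) - z in the variable z, with
   coefficients in C[rho], where c_i = c + rho * zeta_k^{p_i}. *)
Definition ci_poly (c : C) (k : nat) (pi_ : nat) : {poly C} :=
  c%:P + (zeta k ^+ pi_) *: 'X.

Definition fquad_poly (a : {poly C}) : {poly {poly C}} := 'X ^+ 2 + a%:P.

Definition comp_poly_seq (c : C) (k : nat) (ps : seq nat) : {poly {poly C}} :=
  foldl (fun P pi_ => fquad_poly (ci_poly c k pi_) \Po P) 'X ps.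

Definition Delta (c : C) (k : nat) (ps : seq nat) : {poly C} :=
  disc_monic (comp_poly_seq c k ps - 'X).

End Defs.

(* Main.v *)
(* Suppose r > |rho0| and let L be a nonempty bounded set invariant under every
   f_c', |c' - c| <= r. Perturbing the parameters along an orbit by linear terms
   in an auxiliary variable x, |x| <= 1, gives polynomials in x, so that Cauchy's
   estimate bounds their derivative at 0; rotating the perturbations makes the
   contributions of all steps add up.

   Forward orbits: if z_0 is in L, the perturbed orbit stays in L, whence, with
   p_n := prod_(i < n) |2 z_i|, a bound on p_n * sum_(0 < j <= n) 1 / p_j that is
   uniform in n.

   Backward orbits: pulling back by z |-> z^2 + c' is possible as long as one
   stays off a set that contains the critical point and is mapped into itself.
   Square roots are replaced by polynomial approximations obtained from Newton's
   method; the error is absorbed into a perturbation of the parameter.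

   If L missed the finite orbit of 0 under f_c, pulling back discs contained in L
   would bound p_n / p_j from below, against the forward estimate; hence 0 is in
   L. When Delta(rho0) = 0, there is an N-periodic orbit of multiplier 1 for
   parameters at distance |rho0| < r from c. It contradicts the forward estimate
   if it starts in L, and otherwise the estimate obtained by pulling back off L. *)
Require Import Defs.
From HB Require Import structures.
From mathcomp Require Import all_boot all_order all_algebra.
From mathcomp Require Import all_classical all_reals.
From mathcomp Require Import ereal topology normedtype trigo.
From mathcomp Require Import complex.
From mathcomp Require Import ring lra.
Import Order.TTheory GRing.Theory Num.Theory.
Import numFieldNormedType.Exports.
Local Open Scope ring_scope.

Set Implicit Arguments.
Unset Strict Implicit.
Unset Printing Implicit Defensive.

(** * The real-valued modulus on the complex numbers *)

Section Modulus.
Variable R : realType.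
Local Notation C := R[i].
Implicit Types (x y z : C).

Lemma modulusE z : `|z| = (modulus z)%:C%C.
Proof. by rewrite /modulus normc_def. Qed.

Lemma modulus_ge0 z : 0 <= modulus z.
Proof. by rewrite -lecR -modulusE normr_ge0. Qed.

Lemma modulusM x y : modulus (x * y) = modulus x * modulus y.
Proof. by apply: complexI; rewrite rmorphM -!modulusE normrM. Qed.

Lemma modulusD x y : modulus (x + y) <= modulus x + modulus y.
Proof. by rewrite -lecR rmorphD -!modulusE ler_normD. Qed.

Lemma modulusN z : modulus (- z) = modulus z.
Proof. by rewrite /modulus normrN. Qed.

Lemma modulusB x y : modulus (x - y) <= modulus x + modulus y.
Proof. by rewrite -(modulusN y) modulusD. Qed.

Lemma modulus_distC x y : modulus (x - y) = modulus (y - x).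
Proof. by rewrite -modulusN opprB. Qed.

Lemma modulus0 : modulus (0 : C) = 0.
Proof. by rewrite /modulus normr0. Qed.

Lemma modulus1 : modulus (1 : C) = 1.
Proof. by rewrite /modulus normr1. Qed.

Lemma modulus_eq0 z : (modulus z == 0) = (z == 0).
Proof. by rewrite -[RHS]normr_eq0 modulusE -(inj_eq (@complexI R)). Qed.

Lemma modulusX z n : modulus (z ^+ n) = modulus z ^+ n.
Proof. by apply: complexI; rewrite rmorphXn -!modulusE normrX. Qed.

Lemma modulusV z : modulus z^-1 = (modulus z)^-1.
Proof. by apply: complexI; rewrite fmorphV -!modulusE normfV. Qed.

Lemma modulus_real (a : R) : 0 <= a -> modulus a%:C%C = a.
Proof. by move=> a0; apply: complexI; rewrite -modulusE ger0_norm ?ler0c. Qed.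

Lemma modulus_nat n : modulus (n%:R : C) = n%:R.
Proof. by apply: complexI; rewrite -modulusE normr_nat rmorph_nat. Qed.

Lemma modulus_sum (I : Type) (s : seq I) (F : I -> C) :
  modulus (\sum_(i <- s) F i) <= \sum_(i <- s) modulus (F i).
Proof.
elim/big_rec2: _ => [|i a b _ IH]; first by rewrite modulus0.
by rewrite (le_trans (modulusD _ _)) // lerD2l.
Qed.

Lemma modulus_unity_root z n : (0 < n)%N -> z ^+ n = 1 -> modulus z = 1.
Proof.
move=> n0 zn; have := modulusX z n; rewrite zn modulus1 => /esym /eqP.
by rewrite pexpr_eq1 // ?modulus_ge0 // => /eqP.
Qed.

Lemma modulus_align y (eta : R) : 0 <= eta ->
  exists2 u : C, modulus u = 1 & modulus (y + eta%:C%C * u) = modulus y + eta.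
Proof.
move=> eta0; have [->|y0] := eqVneq y 0.
  by exists 1; rewrite ?modulus1 // mulr1 add0r modulus0 add0r modulus_real.
have my : modulus y != 0 by rewrite modulus_eq0.
exists (y / (modulus y)%:C%C).
  by rewrite modulusM modulusV modulus_real ?modulus_ge0 // divff.
have -> : y + eta%:C%C * (y / (modulus y)%:C%C)
        = (y / (modulus y)%:C%C) * (modulus y + eta)%:C%C.
  rewrite rmorphD /= mulrDr mulrVK ?unitfE; first by rewrite [_%:C%C * _]mulrC.
  by rewrite -modulusE normr_eq0.
rewrite modulusM modulusM modulusV !modulus_real ?addr_ge0 ?modulus_ge0 //.
by rewrite divff // mul1r.
Qed.

End Modulus.

(** * Roots of unity and Cauchy's estimate for polynomials on the unit disc *)

Lemma prim_root_pow2 (F : numClosedFieldType) j :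
  exists z : F, (2 ^ j.+1).-primitive_root z.
Proof.
pose z : F := (2 ^ j).-root (-1).
have zj : z ^+ (2 ^ j) = -1 by rewrite rootCK // expn_gt0.
have zn : z ^+ (2 ^ j.+1) = 1 by rewrite expnSr exprM zj sqrrN expr1n.
have [m pz] := prim_order_exists (ltac:(by rewrite expn_gt0) : 0 < 2 ^ j.+1)%N zn.
case/(dvdn_pfactor _ _ (isT : prime 2)) => i le_ij Dm.
exists z; move: le_ij; rewrite leq_eqVlt => /orP[/eqP <-|]; first by rewrite -Dm.
rewrite ltnS => le_ij; have : (m %| 2 ^ j)%N by rewrite Dm dvdn_exp2l.
rewrite (prim_order_dvd pz) zj => /eqP n11; have := ltr0n F 2.
by rewrite -[2]/(1 + 1)%R -{1}n11 addNr ltxx.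
Qed.

Section UnitDisc.
Variable R : realType.
Local Notation C := R[i].

Lemma coef1_deriv (P : {poly C}) : P`_1 = (P^`()).[0].
Proof. by rewrite horner_coef0 coef_deriv. Qed.

(** Discrete Cauchy formula: averaging [P(w^j) * w^(-j)] over the [n]-th roots of unity, with [n]
    above the degree, isolates the linear coefficient. The inverse of [w ^+ j] is written
    [(w ^+ j) ^+ n.-1]. *)
Lemma cauchy_coef1 (P : {poly C}) (M : R) :
  (forall x, modulus x <= 1 -> modulus P.[x] <= M) -> modulus P`_1 <= M.
Proof.
move=> PM; have [w pw] := prim_root_pow2 C (size P); set n := (2 ^ _)%N in pw.
have szP : ((size P).+1 < n)%N by exact: ltn_expl.
have n0 : (0 < n)%N by exact: leq_ltn_trans szP.
have n1 : (1 < n)%N by exact: leq_ltn_trans szP.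
have w1 j : modulus (w ^+ j) = 1.
  by rewrite modulusX (modulus_unity_root n0 (prim_expr_order pw)) expr1n.
have geom i : (i < n)%N ->
    \sum_(j < n) (w ^+ j) ^+ i * (w ^+ j) ^+ n.-1 = (i == 1%N)%:R * n%:R.
  move=> lt_in; under eq_bigr => j _ do rewrite -exprD -exprM mulnC exprM.
  have [->|i1] := eqVneq i 1%N.
    rewrite mul1r; under eq_bigr do rewrite add1n prednK // (prim_expr_order pw) expr1n.
    by rewrite sumr_const card_ord.
  (* Modulo [n] the exponent is [i - 1], nonzero since [i < n] differs from 1. *)
  have nw : w ^+ (i + n.-1) != 1.
    rewrite -(prim_order_dvd pw); case: i i1 lt_in => [_ _|[//|i _]].
      by rewrite add0n gtnNdvd // ?ltn_predL // -subn1 subn_gt0.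
    rewrite addSnnS prednK // dvdn_addl // => lt_in.
    by rewrite gtnNdvd // ltnW.
  rewrite mul0r; apply: (mulfI (_ : w ^+ (i + n.-1) - 1 != 0)).
    by rewrite subr_eq0.
  rewrite mulr0 -subrX1 -exprM mulnC exprM (prim_expr_order pw).
  by rewrite expr1n subrr.
have sumE : \sum_(j < n) P.[w ^+ j] * (w ^+ j) ^+ n.-1 = P`_1 * n%:R.
  under eq_bigr do rewrite (horner_coef_wide _ (ltnW (ltnW szP))) mulr_suml.
  rewrite exchange_big /=.
  under eq_bigr => i _.
    under eq_bigr do rewrite -mulrA.
    rewrite -mulr_sumr geom //; over.
  rewrite (bigD1 (Ordinal n1)) //= mul1r big1 ?addr0 //.
  by move=> i; rewrite -val_eqE /= => /negbTE ->; rewrite mul0r mulr0.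
have : modulus (P`_1 * n%:R) <= M * n%:R.
  rewrite -sumE (le_trans (modulus_sum _ _)) //.
  rewrite -[n in leRHS](card_ord n) mulr_natr -sumr_const ler_sum // => j _.
  by rewrite modulusM modulusX w1 expr1n mulr1 PM // w1.
by rewrite modulusM modulus_nat ler_pM2r // ltr0n.
Qed.

Lemma horner_bounded (P : {poly C}) :
  exists2 B : R, 0 < B & forall x, modulus x <= 1 -> modulus P.[x] <= B.
Proof.
elim/poly_ind: P => [|P a [B B0 PB]].
  by exists 1 => // x _; rewrite horner0 modulus0.
exists (B + modulus a); first by rewrite ltr_pwDl ?modulus_ge0.
move=> x x1; rewrite hornerMXaddC (le_trans (modulusD _ _)) // lerD2r modulusM.
rewrite -[leRHS]mulr1 ler_pM ?modulus_ge0 //; exact: PB.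
Qed.

Lemma horner_lipschitz (P : {poly C}) :
  exists2 K : R, 0 < K & forall x y, modulus x <= 1 -> modulus y <= 1 ->
    modulus (P.[x] - P.[y]) <= K * modulus (x - y).
Proof.
elim/poly_ind: P => [|P a [K K0 PK]].
  by exists 1 => // x y _ _; rewrite !horner0 subrr modulus0 mul1r modulus_ge0.
have [B B0 PB] := horner_bounded P.
exists (B + K); first by rewrite addr_gt0.
move=> x y x1 y1; rewrite !hornerMXaddC.
have -> : P.[x] * x + a - (P.[y] * y + a)
        = P.[x] * (x - y) + (P.[x] - P.[y]) * y by ring.
rewrite (le_trans (modulusD _ _)) // !modulusM mulrDl lerD //.
  by rewrite ler_wpM2r ?modulus_ge0 // PB.
by rewrite -[leRHS]mulr1 ler_pM ?modulus_ge0 // PK.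
Qed.

End UnitDisc.

(** * Polynomial approximation of square roots by Newton's method *)

Section NewtonSquareRoot.
Variable R : realType.
Local Notation C := R[i].
Implicit Types (Q V : {poly C}).

Let hornerR := (@horner_exp C, @hornerM C, @hornerD C, @hornerN C, @hornerC C,
  @hornerZ C, @hornerX C).

Definition residual Q V : {poly C} := 1 - Q * V ^+ 2.

(* One Newton step for the equation [1 / V ^ 2 = Q]. It involves no division
   by [Q] or [V], hence stays within polynomials. *)
Definition newton Q V : {poly C} := V * (1 + (2^-1)%:P * residual Q V).

Lemma residual_newton Q V :
  residual Q (newton Q V) =
  residual Q V ^+ 2 * (1 - (2^-1)%:P ^+ 2 + (2^-1)%:P ^+ 2 * residual Q V).
Proof.
rewrite /newton; set h := (2^-1)%:P.
have h2 : 1 - h * 2%:P = 0 by rewrite -polyCM mulVf ?pnatr_eq0 // subrr.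
set E := residual Q V; have EQ : Q * V ^+ 2 = 1 - E by rewrite opprB addrC subrK.
rewrite /residual exprMn mulrA EQ.
(* [ring] sees [h] as an atom, so the term that vanishes by [2 h = 1] is split off first. *)
transitivity (E ^+ 2 * (1 - h ^+ 2 + h ^+ 2 * E) + (E - E ^+ 2) * (1 - h * 2%:P)).
  rewrite polyCMn; ring.
by rewrite h2 mulr0 addr0.
Qed.

(** The new residual is [E^2 (3 + E) / 4], and [|3 + E| <= 4]. *)
Lemma newton_contract Q V x (d : R) : modulus (residual Q V).[x] <= d -> d <= 1 ->
  modulus (residual Q (newton Q V)).[x] <= d ^+ 2.
Proof.
set E := (residual Q V).[x] => Ed d1.
have -> : (residual Q (newton Q V)).[x] = E ^+ 2 * (4^-1 * (3 + E)).
  by rewrite residual_newton /E /residual !hornerR; field.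
have E0 := modulus_ge0 E.
rewrite modulusM modulusX -[leRHS]mulr1 ler_pM ?exprn_ge0 ?modulus_ge0 //.
  by rewrite lerXn2r // ?nnegrE ?(le_trans E0).
rewrite modulusM modulusV modulus_nat.
have := modulusD 3 E; rewrite modulus_nat; lra.
Qed.

Lemma newton0 Q V s : s ^+ 2 = Q.[0] -> V.[0] * s = 1 ->
  (newton Q V).[0] * s = 1.
Proof.
move=> sQ Vs; rewrite /newton /residual !hornerR -sQ.
by rewrite -exprMn [s * _]mulrC Vs expr1n subrr mulr0 addr0 mulr1.
Qed.

(** As [m |V|^2 <= |Q V^2| <= 5/4], passing from [Q] to [Q'] changes the residual by at most 1/4;
    the Newton step squares the resulting bound 1/2 back to 1/4. *)
Lemma newton_perturb Q Q' V x (m : R) : 0 < m ->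
  m <= modulus Q.[x] -> modulus (Q'.[x] - Q.[x]) <= m / 5 ->
  modulus (residual Q V).[x] <= 4^-1 ->
  modulus (residual Q' (newton Q' V)).[x] <= 4^-1.
Proof.
move=> m0 mQ QQ' EQ; have -> : 4^-1 = (2^-1) ^+ 2 :> R by field.
apply: newton_contract; last by lra.
have -> : (residual Q' V).[x] = (residual Q V).[x] - (Q'.[x] - Q.[x]) * V.[x] ^+ 2.
  by rewrite /residual !hornerR; ring.
rewrite (le_trans (modulusB _ _)) // modulusM modulusX.
have QV : modulus Q.[x] * modulus V.[x] ^+ 2 <= 5 / 4.
  rewrite -modulusX -modulusM.
  have -> : Q.[x] * V.[x] ^+ 2 = 1 - (residual Q V).[x].
    by rewrite /residual !hornerR; ring.
  by have := modulusB 1 (residual Q V).[x]; rewrite modulus1; lra.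
have V0 : 0 <= modulus V.[x] ^+ 2 by rewrite exprn_ge0 ?modulus_ge0.
have := ler_wpM2r V0 mQ; have := ler_wpM2r V0 QQ'.
by rewrite -mulrA [5^-1 * _]mulrC mulrA; lra.
Qed.

(** Continuation in [t] along [Q(t x)]: at [t = 0] the constant [1 / s] is exact, and one Newton
    step repairs each of [K] small increments of [t]. *)
Lemma inverse_sqrt_start Q (m : R) s : 0 < m ->
  (forall x, modulus x <= 1 -> m <= modulus Q.[x]) -> s ^+ 2 = Q.[0] ->
  exists2 V, V.[0] * s = 1 &
    forall x, modulus x <= 1 -> modulus (residual Q V).[x] <= 4^-1.
Proof.
move=> m0 mQ sQ.
have s0 : s != 0.
  apply: contraTneq (mQ 0 _) => [s0|]; last by rewrite modulus0 ler01.
  by rewrite -ltNge -sQ s0 expr0n modulus0.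
have [L L0 QL] := horner_lipschitz Q.
have [K0 K0L] : exists K, 5 * L / m < K%:R.
  by exists (Num.bound (5 * L / m)); rewrite archi_boundP // divr_ge0 ?mulr_ge0 ?ltW.
(* An increment [1 / K] moves [Q] by at most [L / K <= m / 5], as [newton_perturb] demands. *)
pose K := K0.+1; have KL : L / K%:R <= m / 5.
  have : 5 * L <= K%:R * m.
    by rewrite -ler_pdivrMr // (le_trans (ltW K0L)) // ler_nat leqnSn.
  by rewrite ler_pdivrMr ?ltr0n //; lra.
pose t i : C := (i%:R / K%:R : R)%:C%C.
have t1 i x : (i <= K)%N -> modulus x <= 1 -> modulus (t i * x) <= 1.
  move=> iK x1; rewrite modulusM modulus_real ?divr_ge0 ?ler0n //.
  rewrite -[leRHS]mulr1 ler_pM ?modulus_ge0 ?divr_ge0 ?ler0n //.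
  by rewrite ler_pdivrMr ?ltr0n // mul1r ler_nat.
pose Qt i := Q \Po (t i *: 'X).
have QtE i x : (Qt i).[x] = Q.[t i * x] by rewrite horner_comp !hornerR.
suff [V Vs EV] : exists2 V, V.[0] * s = 1 &
    forall x, modulus x <= 1 -> modulus (residual (Qt K) V).[x] <= 4^-1.
  exists V => // x /EV; rewrite /residual !hornerR QtE /t divff ?mul1r //.
  by rewrite pnatr_eq0.
have: (K <= K)%N by []; elim: {1 3}K => [_|i IH ltiK].
  exists (s^-1)%:P => [|x _]; first by rewrite hornerC mulVf.
  rewrite /residual !hornerR QtE /t mul0r mul0r -sQ exprVn divff ?expf_neq0 //.
  by rewrite subrr modulus0 invr_ge0.
have [V Vs EV] := IH (ltnW ltiK).
exists (newton (Qt i.+1) V) => [|x x1].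
  by apply: newton0 => //; rewrite QtE mulr0.
apply: (@newton_perturb (Qt i) _ _ _ m) => //; last exact: EV.
  by rewrite QtE mQ // t1 // ltnW.
rewrite !QtE (le_trans (QL _ _ _ _)) ?t1 // ?(ltnW ltiK) //.
rewrite -mulrBl modulusM -rmorphB /= -mulrBl -natrB // subSnn.
rewrite modulus_real ?divr_ge0 // mulrA (le_trans _ KL) // mulrA mulr1.
by rewrite ler_piMr ?divr_ge0 // ltW.
Qed.

(** If [W] approximates [Q^(-1/2)] with residual [E], then [S = Q W] satisfies [S^2 = Q - Q E].
    Iteration makes [E] small on the disc; its vanishing to second order at 0 makes the linear
    coefficient of [S] exact. *)
Lemma poly_sqrt_approx Q (m e : R) s : 0 < m -> 0 < e ->
  (forall x, modulus x <= 1 -> m <= modulus Q.[x]) -> s ^+ 2 = Q.[0] ->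
  exists S : {poly C}, [/\ S.[0] = s, 2 * s * S`_1 = Q`_1 &
    forall x, modulus x <= 1 -> modulus (S.[x] ^+ 2 - Q.[x]) <= e].
Proof.
move=> m0 e0 mQ sQ; have [B B0 QB] := horner_bounded Q.
have [n nB] : exists n, B / e < n%:R.
  by exists (Num.bound (B / e)); rewrite archi_boundP // divr_ge0 ?ltW.
(* A Newton step suffices to go from [1 / (k + 4)] to [1 / (k + 5)], since it squares the bound. *)
have [V Vs EV] : exists2 V, V.[0] * s = 1 &
    forall x, modulus x <= 1 -> modulus (residual Q V).[x] <= n.+4%:R^-1.
  elim: (n) => [|k [V Vs EV]]; first exact: (inverse_sqrt_start m0 mQ sQ).
  exists (newton Q V) => [|x x1]; first exact: newton0.
  apply: (le_trans (newton_contract (EV x x1) _)).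
    by rewrite invf_le1 ?ltr0n // ler1n.
  rewrite exprVn lef_pV2 ?posrE ?exprn_gt0 ?ltr0n //.
  by rewrite -natrX ler_nat expnS expn1 mulSn -addn1 leq_add2l muln_gt0.
(* The residual of [V] vanishes at 0. A further step squares it up to a factor, so [E] vanishes
   there together with its derivative. *)
pose W := newton Q V; pose E := residual Q W.
have Ws : W.[0] * s = 1 by exact: newton0.
have SE : (Q * W) ^+ 2 = Q - Q * E by rewrite /E /residual; ring.
have S0 : (Q * W).[0] = s by rewrite hornerM -sQ expr2 -mulrA [s * W.[0]]mulrC Ws mulr1.
move: (Q * W) SE S0 => S SE S0; exists S; split => //.
- have E0 : (residual Q V).[0] = 0.
    by rewrite /residual !hornerR -sQ mulrC -exprMn Vs expr1n subrr.
  have dE : (E^`()).[0] = 0.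
    rewrite /E residual_newton; move: (residual Q V) E0 => F F0.
    rewrite derivM expr2 derivM !hornerR F0.
    by rewrite !(mul0r, mulr0, addr0).
  have E0' : E.[0] = 0.
    by rewrite /E residual_newton hornerM horner_exp E0 expr0n mul0r.
  clearbody E; have := congr1 (fun P => (deriv P).[0]) SE.
  rewrite expr2 derivM derivB [(Q * E)^`()]derivM !(hornerD, hornerN, hornerM).
  rewrite S0 dE E0' !mulr0 addr0 subr0 -!coef1_deriv => <-; ring.
- move=> x x1; rewrite -horner_exp SE hornerD hornerN hornerM -/E.
  have -> : Q.[x] - Q.[x] * E.[x] - Q.[x] = - (Q.[x] * E.[x]) by ring.
  rewrite modulusN modulusM; have n4 : 0 < n.+4%:R :> R by rewrite ltr0n.
  have En : modulus E.[x] <= n.+4%:R^-1.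
    apply: le_trans (newton_contract (EV x x1) _) _; first by rewrite invf_le1 ?ler1n.
    by rewrite expr2 ler_piMl ?invr_ge0 ?invf_le1 ?ler1n.
  apply: (@le_trans _ _ (B * n.+4%:R^-1)).
    by rewrite ler_pM ?modulus_ge0 ?QB.
  rewrite ler_pdivrMr // mulrC -ler_pdivrMr // (le_trans (ltW nB)) //.
  by rewrite ler_nat -addn4 leq_addr.
Qed.

End NewtonSquareRoot.

(** * Orbits of varying quadratic maps and their perturbations *)

Section Orbits.
Variable R : realType.
Local Notation C := R[i].
Implicit Types (c : C) (r eta : R) (cs z : nat -> C) (L : C -> Prop).

Definition quad_orbit cs z := forall i, z i.+1 = z i ^+ 2 + cs i.

(** The modulus of the derivative at [z 0] of the composition of the first [n] maps. *)
Definition multiplier z n : R := \prod_(i < n) modulus (2 * z i).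

Definition invariant_set c r L :=
  forall x c' : C, L x -> modulus (c' - c) <= r -> L (x ^+ 2 + c').

Lemma multiplier_ge0 z n : 0 <= multiplier z n.
Proof. by apply: prodr_ge0 => i _; exact: modulus_ge0. Qed.

Lemma multiplierS z n : multiplier z n.+1 = multiplier z n * modulus (2 * z n).
Proof. by rewrite /multiplier big_ord_recr. Qed.

Lemma multiplierD z m n :
  multiplier z (m + n) = multiplier z m * multiplier (fun i => z (m + i)%N) n.
Proof.
elim: n => [|n IH]; first by rewrite addn0 /multiplier big_ord0 mulr1.
by rewrite addnS !multiplierS IH mulrA.
Qed.

Lemma multiplier_neq0 z n : (forall i, (i < n)%N -> z i != 0) ->
  multiplier z n != 0.
Proof.
move=> z0; apply/prodf_neq0 => i _.
by rewrite modulus_eq0 mulf_neq0 ?pnatr_eq0 ?z0.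
Qed.

(* The perturbations are rotated so that the derivatives of the orbit with
   respect to the parameter add up without cancellation. *)
Lemma forward_family L c r eta cs z : invariant_set c r L -> 0 <= eta ->
  (forall i, modulus (cs i - c) + eta <= r) -> quad_orbit cs z ->
  (forall i, z i != 0) -> L (z 0) ->
  forall n, exists P : {poly C}, [/\ P.[0] = z n,
    modulus P`_1 = eta * (multiplier z n * \sum_(j < n) (multiplier z j.+1)^-1)
    & forall x, modulus x <= 1 -> L P.[x]].
Proof.
move=> invL eta0 csr zS z0 Lz; elim=> [|n [P [P0 P1 LP]]].
  exists (z 0)%:P; split=> [||x _]; rewrite ?hornerC //.
  by rewrite coefC /= modulus0 big_ord0 !mulr0.
have [u u1 uE] := modulus_align (2 * z n * P`_1) eta0.
exists (P ^+ 2 + ((cs n)%:P + (eta%:C%C * u) *: 'X)); split=> [||x x1].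
- by rewrite !hornerD horner_exp hornerC hornerZ hornerX mulr0 addr0 P0 zS.
- rewrite coefD coefD coefC coefZ coefX /= mulr1 add0r.
  have -> : (P ^+ 2)`_1 = 2 * z n * P`_1.
    by rewrite !coef1_deriv expr2 derivM !(hornerD, hornerM) P0; ring.
  rewrite uE modulusM P1 big_ord_recr /= multiplierS mulrDr mulrDr mulfV ?mulr1.
    by congr (_ + _); ring.
  by rewrite -multiplierS multiplier_neq0.
- rewrite !hornerD horner_exp hornerC hornerZ hornerX; apply: invL; first exact: LP.
  rewrite addrAC (le_trans (modulusD _ _)) // (le_trans _ (csr n)) // lerD2l.
  by rewrite !modulusM u1 mulr1 modulus_real // ler_piMr.
Qed.

(** Each pull-back takes an approximate root [S] of [Q = P - q], where the linear [q] is the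
    perturbed parameter. The margin [eps] absorbs the error: [S] is an exact preimage of [P] under
    the parameter [P - S^2]. *)
Lemma backward_family c r eta eps M cs z (V : nat -> C -> Prop) n (P : {poly C}) :
  (forall i x c', (i < n)%N -> modulus (c' - c) <= r ->
     V i.+1 (x ^+ 2 + c') -> V i x) ->
  (forall i, (i < n)%N -> ~ V i 0) -> 0 <= eta -> 0 < eps ->
  (forall i, modulus (cs i - c) + eta + eps <= r) -> quad_orbit cs z ->
  1 + modulus c + r <= M -> P.[0] = z n ->
  (forall x, modulus x <= 1 -> V n P.[x] /\ modulus P.[x] <= M) ->
  exists S : {poly C}, [/\ S.[0] = z 0,
    modulus S`_1 = modulus P`_1 / multiplier z n
                   + eta * \sum_(j < n) (multiplier z j.+1)^-1
    & forall x, modulus x <= 1 -> V 0%N S.[x] /\ modulus S.[x] <= M].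
Proof.
move=> + + eta0 eps0 csr zS crM; elim: n P => [|n IH] P invV V0 P0 VP.
  exists P; split=> //.
  by rewrite big_ord0 mulr0 addr0 /multiplier big_ord0 divr1.
have [u u1 uE] := modulus_align (- P`_1) eta0.
pose q := (cs n)%:P + (eta%:C%C * u) *: 'X; pose Q := P - q.
have qE x : q.[x] = cs n + eta%:C%C * u * x.
  by rewrite hornerD hornerC hornerZ hornerX.
have qr x : modulus x <= 1 -> modulus (q.[x] - c) + eps <= r.
  move=> x1; rewrite qE addrAC (le_trans _ (csr n)) // lerD2r.
  rewrite (le_trans (modulusD _ _)) // lerD2l.
  by rewrite !modulusM u1 mulr1 modulus_real // ler_piMr.
have QE x : Q.[x] = P.[x] - q.[x] by rewrite hornerD hornerN.
have epsQ x : modulus x <= 1 -> eps <= modulus Q.[x].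
  (* If [|Q(x)| < eps], an admissible parameter sends 0 to [P(x)], so [V n] would contain 0. *)
  move=> x1; rewrite leNgt; apply/negP => ltQ; apply: (V0 n (ltnSn n)).
  apply: (invV n 0 P.[x] (ltnSn n)); last by rewrite expr0n add0r; case: (VP x x1).
  have -> : P.[x] - c = Q.[x] + (q.[x] - c) by rewrite QE; ring.
  by rewrite (le_trans (modulusD _ _)) //; have := qr x x1; lra.
have zQ : z n ^+ 2 = Q.[0] by rewrite QE qE P0 zS mulr0 addr0 addrK.
have [S [S0 S1 SQ]] := poly_sqrt_approx eps0 eps0 epsQ zQ.
have zn0 : modulus (2 * z n) != 0.
  rewrite modulus_eq0 mulf_neq0 ?pnatr_eq0 //.
  apply: contraTneq (epsQ 0 _) => [zn0|]; last by rewrite modulus0 ler01.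
  by rewrite -ltNge -zQ zn0 expr0n modulus0.
have VS x : modulus x <= 1 -> V n S.[x] /\ modulus S.[x] <= M.
  move=> x1; pose c' := P.[x] - S.[x] ^+ 2.
  have [VPx PM] := VP x x1.
  have c'r : modulus (c' - c) <= r.
    have -> : c' - c = (q.[x] - c) - (S.[x] ^+ 2 - Q.[x]) by rewrite /c' QE; ring.
    rewrite (le_trans (modulusB _ _)) //.
    by have := SQ x x1; have := qr x x1; lra.
  split; first by apply: (invV n _ c') => //; rewrite /c' addrC subrK.
  have SM : modulus S.[x] ^+ 2 <= M + modulus c + r.
    rewrite -modulusX; have -> : S.[x] ^+ 2 = P.[x] - (c' - c) - c by rewrite /c'; ring.
    have := modulusB (P.[x] - (c' - c)) c; have := modulusB P.[x] (c' - c); lra.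
  have r0 : 0 <= r by have := modulus_ge0 (c' - c); lra.
  (* [|S|^2 <= M + |c| + r <= 2 M - 1 <= M^2]. *)
  have := modulus_ge0 c; rewrite leNgt => c0; apply/negP => ltM; nra.
have Q1 : modulus Q`_1 = modulus P`_1 + eta.
  rewrite -(modulusN P`_1) -uE -modulusN; congr modulus.
  by rewrite /Q /q !(coefB, coefN, coefD, coefC, coefZ, coefX) /=; ring.
have [T [T0 T1 VT]] := IH S (fun i x c' lt_in => invV i x c' (ltnW lt_in))
  (fun i lt_in => V0 i (ltnW lt_in)) S0 VS.
exists T; split=> //; rewrite T1 big_ord_recr /= multiplierS.
have -> : modulus S`_1 = (modulus P`_1 + eta) / modulus (2 * z n).
  by rewrite -Q1 -S1 [modulus (_ * S`_1)]modulusM mulrAC mulfV // mul1r.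
by rewrite invfM; ring.
Qed.

Definition bounded_by (M : R) L := forall x : C, L x -> modulus x <= M.

Lemma forward_bound L c r eta M cs z : invariant_set c r L -> bounded_by M L ->
  0 <= eta -> (forall i, modulus (cs i - c) + eta <= r) -> quad_orbit cs z ->
  (forall i, z i != 0) -> L (z 0) -> forall n,
  eta * (multiplier z n * \sum_(j < n) (multiplier z j.+1)^-1) <= M.
Proof.
move=> invL LM eta0 csr zS z0 Lz n.
have [P [_ <- LP]] := forward_family invL eta0 csr zS z0 Lz n.
by apply: cauchy_coef1 => x x1; apply/LM/LP.
Qed.

Fixpoint reachable c r n (x : C) : Prop :=
  if n is m.+1 then
    exists y c' : C, [/\ reachable c r m y, modulus (c' - c) <= r & x = y ^+ 2 + c']
  else x = 0.

Lemma reachable_le c r r' n x : r <= r' -> reachable c r n x -> reachable c r' n x.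
Proof.
move=> rr'; elim: n x => [//|n IH] x [y [c' [/IH Hy c'r ->]]].
by exists y, c'; split=> //; exact: le_trans rr'.
Qed.

Lemma reachable_stable c n (s : R) : 0 < s -> exists2 r : R, 0 < r &
  forall j (x : C), (j <= n)%N -> reachable c r j x ->
    modulus (x - iter j (fquad c) 0) <= s.
Proof.
elim: n s => [|n IH] s s0.
  exists 1 => // j x; rewrite leqn0 => /eqP -> /= ->.
  by rewrite subrr modulus0 ltW.
set w := iter n (fquad c) 0; have w0 := modulus_ge0 w.
(* [|(y - w) (y - w + 2 w)| <= s1 (1 + 2 |w|) = s1 b / 2 <= s / 2]; the other half of [s] is left
   for the parameter. *)
pose b := 2 * (2 * modulus w + 1); have b0 : 0 < b by rewrite /b; lra.
pose s1 := Num.min (Num.min 1 s) (s / b).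
have s10 : 0 < s1 by rewrite !lt_min ltr01 s0 divr_gt0.
have [r1 r10 r1P] := IH s1 s10.
have s1s : s1 <= s by rewrite !ge_min lexx orbT.
have s11 : s1 <= 1 by rewrite !ge_min lexx.
have s1b : s1 * b <= s by rewrite -ler_pdivlMr // !ge_min lexx !orbT.
exists (Num.min r1 (s / 2)); first by rewrite lt_min r10 divr_gt0.
move=> j x; rewrite leq_eqVlt => /orP[/eqP ->|ltj] Hx; last first.
  apply: le_trans s1s; apply: r1P => //; apply: reachable_le Hx.
  by rewrite ge_min lexx.
case: Hx => y [c' [Hy c'r ->]].
have yw : modulus (y - w) <= s1.
  by apply: r1P => //; apply: reachable_le Hy; rewrite ge_min lexx.
have c's : modulus (c' - c) <= s / 2 by rewrite (le_trans c'r) // ge_min lexx orbT.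
have -> : y ^+ 2 + c' - iter n.+1 (fquad c) 0
        = (y - w) * ((y - w) + 2 * w) + (c' - c).
  by rewrite iterS -/w /fquad; ring.
rewrite (le_trans (modulusD _ _)) // modulusM.
have := modulusD (y - w) (2 * w); rewrite modulusM modulus_nat.
have := modulus_ge0 (y - w); have := modulus_ge0 (y - w + 2 * w).
rewrite /b in s1b; move: c's s1b yw w0 s11.
move: (modulus _) (modulus _) (modulus _) (modulus _) => m1 m2 m3 m4.
move=> ? ? ? ? ? ? ? ?; nra.
Qed.

End Orbits.

(** * The critical point and neutral cycles relative to a bounded invariant set *)

Section CriticalPoint.
Variable R : realType.
Local Notation C := R[i].

(** The disc of radius [r / 2] about [z n] is pulled back [n] times within the ball of radius [M],
    so Cauchy's estimate bounds [(r / 2) / multiplier z n]. The tolerance [r'] on the parameters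
    depends on [n], the final bound does not. *)
Lemma multiplier_lower_bound (L : C -> Prop) (c : C) (r M : R) (z : nat -> C) :
  0 < r -> bounded_by M L -> 1 + modulus c + r <= M ->
  (forall j, ~ L (iter j (fquad c) 0)) -> quad_orbit (fun=> c) z ->
  (forall i v, modulus v <= r -> L (z i + v)) ->
  forall n, r / 2 <= M * multiplier z n.
Proof.
move=> r0 LM crM nL zS Lz n; have r20 : 0 < r / 2 by rewrite divr_gt0.
have [r1 r10 r1P] := reachable_stable c n r20.
pose r' := Num.min r r1; have r'0 : 0 < r' by rewrite lt_min r0.
(* The index drops with each pull-back, so only points reachable in at most [n] steps must stay near
   the critical orbit. *)
pose V i (x : C) := ~ exists2 j, (j <= i)%N & reachable c r' j x.
have invV i (x c' : C) : (i < n)%N -> modulus (c' - c) <= r' ->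
    V i.+1 (x ^+ 2 + c') -> V i x.
  move=> _ c'r Vx [j ji Hx]; apply: Vx; exists j.+1 => //.
  by exists x, c'.
have V0 i : (i < n)%N -> ~ V i 0 by move=> _; apply; exists 0%N.
have crM' : 1 + modulus c + r' <= M by rewrite (le_trans _ crM) // lerD2l ge_min lexx.
pose P : {poly C} := (z n)%:P + (r / 2)%:C%C *: 'X.
have PE x : P.[x] = z n + (r / 2)%:C%C * x by rewrite hornerD hornerC hornerZ hornerX.
have xr x : modulus x <= 1 -> modulus ((r / 2)%:C%C * x) <= r / 2.
  by move=> x1; rewrite modulusM modulus_real ?(ltW r20) // ler_piMr ?(ltW r20).
have VP (x : C) : modulus x <= 1 -> V n P.[x] /\ modulus P.[x] <= M.
  move=> /xr x1; rewrite PE; split; last by apply/LM/Lz; lra.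
  move=> [j jn Hj]; apply: (nL j).
  have {Hj} : reachable c r1 j (z n + (r / 2)%:C%C * x).
    by apply: reachable_le Hj; rewrite ge_min lexx orbT.
  move=> /(r1P _ _ jn); set w := iter j _ 0 => jw.
  (* The point [w] of the critical orbit would lie within [r / 2 + r / 2] of [z n], hence in [L]. *)
  have -> : w = z n + ((r / 2)%:C%C * x - (z n + (r / 2)%:C%C * x - w)) by ring.
  apply: Lz; rewrite (le_trans (modulusB _ _)) //; lra.
have csr (i : nat) : modulus (c - c) + 0 + r' <= r' by rewrite subrr modulus0 !add0r.
have P0 : P.[0] = z n by rewrite PE mulr0 addr0.
have [S [_ S1 VS]] :=
  backward_family invV V0 (lexx 0) r'0 csr zS crM' P0 VP.
have := cauchy_coef1 (fun x x1 => (VS x x1).2).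
rewrite S1 mul0r addr0 /P coefD coefC coefZ coefX /= mulr1 add0r modulus_real ?(ltW r20) //.
rewrite ler_pdivrMr // lt_def multiplier_ge0 andbT multiplier_neq0 // => i _.
apply: contra_notN (nL 0%N) => /eqP zi.
by rewrite /= -[0](addr0 (0 : C)) -{1}zi; apply: Lz; rewrite modulus0 ltW.
Qed.

(* Inverse branches bound the multipliers along an orbit in [L] from below when
   [L] misses the critical orbit, while [forward_bound] makes them summable. *)
Lemma critical_point_in_invariant_set (L : C -> Prop) (c : C) (r M : R) y :
  superattracting c -> 0 < r -> invariant_set c r L -> bounded_by M L -> L y -> L 0.
Proof.
move=> [q [q0 cq]] r0 invL LM Ly; apply: contrapT => nL0.
have cr : modulus (c - c) <= r by rewrite subrr modulus0 ltW.
have Lf x : L x -> L (fquad c x) by move=> Lx; apply: invL.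
have Liter k x : L x -> L (iter k (fquad c) x).
  by move=> Lx; elim: k => //= k; exact: Lf.
have nL j : ~ L (iter j (fquad c) 0).
  (* As [q] iterations return 0 to itself, iterating on from time [j] to time [q * j] leads back to
     0. *)
  move=> Lj; apply: nL0; have <- : iter (q * j) (fquad c) 0 = 0.
    by elim: (j) => [|i IH]; rewrite ?muln0 // mulnS iterD IH.
  have -> : (q * j = (q * j - j) + j)%N by rewrite subnK // leq_pmull.
  by rewrite iterD; exact: Liter.
(* Starting at the image of [y] makes every [z i] the image of a point of [L]; varying the parameter
   then puts the disc of radius [r] about it into [L]. *)
pose z i := iter i.+1 (fquad c) y.
have zS : quad_orbit (fun=> c) z by move=> i.
have Lz i v : modulus v <= r -> L (z i + v).
  move=> vr; rewrite /z iterS /fquad -addrA; apply: invL; first exact: Liter.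
  by rewrite addrAC subrr add0r.
have Lz0 i : L (z i) by exact: Liter.
have z0 i : z i != 0 by apply: contra_notN nL0 => /eqP <-.
pose M' := M + (1 + modulus c + r).
have M0 : 0 <= M := le_trans (modulus_ge0 y) (LM y Ly).
have c0 := modulus_ge0 c.
have M'0 : 0 < M' by rewrite /M'; lra.
have LM' : bounded_by M' L by move=> x /LM; rewrite /M'; lra.
have crM' : 1 + modulus c + r <= M' by rewrite /M'; lra.
have [k k0 low] : exists2 k : R, 0 < k &
    forall m n, k <= multiplier (fun i => z (m + i)%N) n.
  exists (r / 2 / M') => [|m n]; first by rewrite !divr_gt0.
  rewrite ler_pdivrMr // [leRHS]mulrC.
  apply: (@multiplier_lower_bound L c) => // [i|i v]; last exact: Lz.
  by rewrite addnS.
have csr (i : nat) : modulus (c - c) + r <= r by rewrite subrr modulus0 add0r.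
have [n nM] : exists n, M / (r * k) < n%:R.
  by exists (Num.bound (M / (r * k))); rewrite archi_boundP // divr_ge0 // ltW // mulr_gt0.
have := forward_bound invL LM (ltW r0) csr zS z0 (Lz0 0%N) n.
apply/negP; rewrite -ltNge; move: nM; rewrite ltr_pdivrMr ?mulr_gt0 // => nM.
(* Each of the [n] quotients [multiplier z n / multiplier z j.+1] is the multiplier of a tail of the
   orbit, hence at least [k]. *)
apply: lt_le_trans nM _; rewrite mulrCA ler_pM2l // mulrC mulr_natr.
rewrite -[n in leLHS](card_ord n) -sumr_const mulr_sumr ler_sum // => j _.
rewrite -[X in multiplier z X / _](subnKC (ltn_ord j)).
rewrite multiplierD mulrAC mulfV ?mul1r ?multiplier_neq0 //; exact: low.
Qed.

Lemma sum_periodic_ge (f : nat -> R) N K : (forall i, 0 <= f i) ->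
  (forall l, f (N.+1 * l + N)%N = 1) -> K%:R <= \sum_(i < N.+1 * K) f i.
Proof.
move=> f0 f1; elim: K => [|K IH]; first by rewrite muln0 big_ord0.
rewrite mulnS addnC big_split_ord /= -addn1 natrD lerD //.
by rewrite big_ord_recr /= f1 lerDr sumr_ge0.
Qed.

(** Multiplier 1 adds at least 1 to the sum of inverse multipliers in each period, which excludes a
    bound uniform in the number [K] of periods. *)
Lemma no_neutral_cycle (L : C -> Prop) (c : C) (r r0 M : R) cs (z : nat -> C) N :
  invariant_set c r L -> bounded_by M L -> L 0 -> r0 < r ->
  (forall i, modulus (cs i - c) <= r0) -> quad_orbit cs z ->
  (forall i, z (N.+1 + i)%N = z i) -> multiplier z N.+1 = 1 -> False.
Proof.
move=> invL LM L0 r0r csr0 zS zN mN.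
have zNl l i : z (N.+1 * l + i)%N = z i.
  by elim: l => [|l IH]; rewrite ?muln0 // mulnS -addnA zN.
have mNl l : multiplier z (N.+1 * l) = 1.
  elim: l => [|l IH]; first by rewrite muln0 /multiplier big_ord0.
  by rewrite mulnS multiplierD mN mul1r -IH; apply: eq_bigr => i _; rewrite zN.
(* One half of the gap perturbs the parameters, the other is the tolerance [eps] of
   [backward_family]. *)
pose eta := (r - r0) / 2; have eta0 : 0 < eta by rewrite divr_gt0 ?subr_gt0.
have r_ge0 : 0 <= r.
  by have := modulus_ge0 (cs 0%N - c); have := csr0 0%N; lra.
have csr (i : nat) : modulus (cs i - c) + eta + eta <= r.
  by rewrite /eta; have := csr0 i; lra.
have csr' i : modulus (cs i - c) + eta <= r by have := csr i; lra.
pose M' := M + (1 + modulus c + r) + modulus (z 0%N).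
have M0 : 0 <= M := le_trans (modulus_ge0 0) (LM 0 L0).
have c0 := modulus_ge0 c; have zz := modulus_ge0 (z 0%N).
have M'0 : 0 <= M' by rewrite /M'; lra.
suff bound K : eta * \sum_(j < N.+1 * K) (multiplier z j.+1)^-1 <= M'.
  have [K KM] : exists K, M' / eta < K%:R.
    by exists (Num.bound (M' / eta)); rewrite archi_boundP // divr_ge0 // ltW.
  have := bound K; apply/negP; rewrite -ltNge.
  move: KM; rewrite ltr_pdivrMr // mulrC => KM; apply: lt_le_trans KM _.
  rewrite ler_pM2l //.
  apply: (@sum_periodic_ge (fun j => (multiplier z j.+1)^-1)) => [i|l].
    by rewrite invr_ge0 multiplier_ge0.
  by rewrite -addnS addnC -mulnS mNl invr1.
have [Lz|nLz] := pselect (L (z 0%N)).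
  have zi0 i : z i != 0.
    have iN : (i < N.+1 * i.+1)%N by rewrite leq_pmull.
    apply: contra_eq_neq (mNl i.+1) => zi; rewrite eq_sym.
    suff -> : multiplier z (N.+1 * i.+1) = 0 by rewrite oner_eq0.
    by rewrite /multiplier (bigD1 (Ordinal iN)) //= zi mulr0 modulus0 mul0r.
  have := forward_bound invL LM (ltW eta0) csr' zS zi0 Lz (N.+1 * K).
  by rewrite mNl mul1r => /le_trans -> //; rewrite /M'; lra.
(* The complement of [L] is backward invariant and misses 0, so the constant polynomial [z 0] can be
   pulled back along the cycle; its linear coefficient 0 leaves only the [eta] sum. *)
have invV i (x c' : C) : (i < N.+1 * K)%N -> modulus (c' - c) <= r ->
    ~ L (x ^+ 2 + c') -> ~ L x.
  by move=> _ c'r nLx Lx; apply: nLx; apply: invL.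
have V0 i : (i < N.+1 * K)%N -> ~ ~ L 0 by move=> _; apply.
have crM : 1 + modulus c + r <= M' by rewrite /M'; lra.
have P0 : ((z 0%N)%:P).[0] = z (N.+1 * K)%N.
  by rewrite hornerC -[in RHS](addn0 (_ * _)%N) zNl.
have VP (x : C) : modulus x <= 1 -> ~ L ((z 0%N)%:P).[x] /\ modulus ((z 0%N)%:P).[x] <= M'.
  by move=> _; rewrite hornerC; split=> //; rewrite /M'; lra.
have [S [_ S1 VS]] :=
  backward_family (V := fun=> fun x => ~ L x) invV V0 (ltW eta0) eta0 csr zS crM P0 VP.
have := cauchy_coef1 (fun x x1 => (VS x x1).2).
by rewrite S1 coefC modulus0 mul0r add0r.
Qed.

End CriticalPoint.

(** * The discriminant and multiple fixed points *)

Section Discriminant.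

Lemma lead_coef_deriv_monic (F : numDomainType) (P : {poly {poly F}}) :
  P \is monic -> (1 < size P)%N -> lead_coef P^`() = (size P).-1%:R.
Proof.
move=> mP sP; case szP : (size P) sP => [|[|n]] //= _.
have Pn : P^`()`_n = n.+1%:R.
  by rewrite coef_deriv -[n.+1]/(n.+2.-1) -szP -lead_coefE (monicP mP).
suff szP' : size P^`() = n.+1 by rewrite lead_coefE szP'.
apply/eqP; rewrite eqn_leq -ltnS -szP lt_size_deriv ?monic_neq0 //= ltnNge.
apply/negP => /leq_sizeP /(_ n (leqnn n)); rewrite Pn => /eqP.
by rewrite -polyC_natr polyC_eq0 pnatr_eq0.
Qed.

(** Evaluation at [a] commutes with the resultant because the leading coefficients, 1 and the
    degree, survive it; a zero resultant then gives a common root. *)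
Lemma disc_monic_root (F : numClosedFieldType) (P : {poly {poly F}}) (a : F)
    (Pa := map_poly (horner_eval a) P) :
  P \is monic -> (1 < size P)%N -> (disc_monic P).[a] = 0 ->
  exists2 x, Pa.[x] = 0 & (Pa^`()).[x] = 0.
Proof.
move=> mP sP; rewrite /disc_monic hornerM => /eqP.
rewrite mulf_eq0 horner_exp hornerN hornerC signr_eq0 /= -[_.[a]]/(horner_eval a _).
rewrite map_resultant ?(monicP mP) ?lead_coef_deriv_monic //.
- rewrite resultant_eq0 -deriv_map -/Pa => szg.
  have /closed_rootP[x] : size (gcdp Pa Pa^`()) != 1%N by rewrite neq_ltn szg orbT.
  by rewrite root_gcd => /andP[/rootP Px /rootP P'x]; exists x.
- by rewrite rmorph1 oner_neq0.
- by rewrite rmorph_nat pnatr_eq0 -lt0n -subn1 subn_gt0.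
Qed.

Variable R : realType.
Local Notation C := R[i].

Lemma comp_poly_seq_rcons (c : C) k ps q :
  comp_poly_seq c k (rcons ps q) =
  comp_poly_seq c k ps ^+ 2 + (ci_poly c k q)%:P.
Proof.
rewrite /comp_poly_seq -cats1 foldl_cat /= /fquad_poly.
by rewrite comp_polyD comp_polyC rmorphXn /= comp_polyX.
Qed.

Lemma comp_poly_seq_monic (c : C) k ps :
  comp_poly_seq c k ps \is monic /\ size (comp_poly_seq c k ps) = (2 ^ size ps).+1.
Proof.
elim/last_ind: ps => [|ps q [mP sP]]; first by rewrite monicX size_polyX.
rewrite comp_poly_seq_rcons size_rcons.
set P := comp_poly_seq c k ps in mP sP *.
have szP2 : size (P ^+ 2) = (2 ^ (size ps).+1).+1.
  by rewrite expr2 size_monicM ?monic_neq0 // sP addSn addnS addnn -mul2n -expnS.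
have lt : (size (ci_poly c k q)%:P < size (P ^+ 2))%N.
  by rewrite szP2 ltnS (leq_trans (size_polyC_leq1 _)) // expn_gt0.
by rewrite size_polyDl // monicE lead_coefDl // -monicE monic_exp.
Qed.

Lemma comp_poly_seq_eval (c : C) k ps rho (cs z : nat -> C)
    (P := map_poly (horner_eval rho) (comp_poly_seq c k ps)) :
  quad_orbit cs z ->
  (forall i, (i < size ps)%N -> cs i = c + zeta R k ^+ nth 0%N ps i * rho) ->
  P.[z 0%N] = z (size ps) /\ (P^`()).[z 0%N] = \prod_(i < size ps) (2 * z i).
Proof.
rewrite /P => {P} zS; elim/last_ind: ps => [_|ps q IH csE].
  by rewrite /comp_poly_seq /= map_polyX derivX hornerX hornerC big_ord0.
have [i lti|Pz P'z] := IH.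
  by rewrite csE ?nth_rcons ?lti // size_rcons leqW.
have csn := csE (size ps); rewrite size_rcons nth_rcons ltnn eqxx in csn.
rewrite comp_poly_seq_rcons rmorphD rmorphXn /= map_polyC /= size_rcons.
rewrite derivD derivC addr0 expr2 derivM !(hornerD, hornerM) hornerC Pz P'z.
split; last by rewrite big_ord_recr /=; ring.
rewrite zS csn // expr2 /horner_eval /ci_poly hornerD hornerC hornerZ hornerX.
by [].
Qed.

Lemma modulus_zeta k : modulus (zeta R k) = 1.
Proof. by rewrite /modulus normc_def /= cos2Dsin2 sqrtr1. Qed.

(** A double root of the composition minus the identity is a fixed point with derivative 1; by the
    chain rule this derivative is the product of the [2 * z i]. *)
Lemma Delta_cycle (c : C) k ps rho (n := size ps) :
  (0 < n)%N -> (Delta c k ps).[rho] = 0 ->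
  exists cs z, [/\ quad_orbit cs z, forall i, z (n + i)%N = z i,
    forall i, modulus (cs i - c) = modulus rho & multiplier z n = 1].
Proof.
move=> n0; have [mP sP] := comp_poly_seq_monic c k ps.
set P := comp_poly_seq c k ps in mP sP.
(* For [n > 0] the composition has degree [2 ^ n > 1], so subtracting ['X] keeps it monic. *)
have ltX : (size (- 'X : {poly {poly C}}) < size P)%N.
  by rewrite size_polyN size_polyX sP ltnS (leq_ltn_trans n0) // ltn_expl.
move=> /disc_monic_root[||x].
- by rewrite monicE lead_coefDl // -monicE.
- by rewrite size_polyDl // (leq_trans _ ltX) // size_polyN size_polyX.
(* The parameters repeat with period [n], so the orbit of the fixed point closes up. *)
pose cs i := c + zeta R k ^+ nth 0%N ps (i %% n) * rho.
pose z := fix z i := if i is j.+1 then z j ^+ 2 + cs j else x.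
have zS : quad_orbit cs z by [].
have [i lti|] := comp_poly_seq_eval (rho := rho) (ps := ps) (k := k) (c := c) zS.
  by rewrite /cs modn_small.
rewrite rmorphB /= map_polyX derivB derivX !(hornerD, hornerN) hornerX hornerC.
rewrite -/P => -> -> /eqP; rewrite subr_eq0 => /eqP zn /eqP.
rewrite subr_eq0 => /eqP prodz; exists cs, z; split=> //.
- elim=> [|i IH]; first by rewrite addn0 -/n in zn *.
  by rewrite addnS !zS IH /cs modnDl.
- move=> i; rewrite /cs addrC addKr modulusM modulusX modulus_zeta.
  by rewrite expr1n mul1r.
- by rewrite /multiplier -(big_morph _ (@modulusM R) (modulus1 R)) prodz modulus1.
Qed.

End Discriminant.

(** * From planar minimal sets to the bound on the bifurcation radius *)

Local Open Scope classical_set_scope.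

Lemma compact_modulus_bounded (R : realType) (L : set R[i]) :
  compact L -> exists M, bounded_by M L.
Proof.
move=> cL; have contm : continuous (@modulus R : R[i] -> R).
  move=> x A /nbhs_ballP[e /= e0 eA]; apply/nbhs_ballP.
  exists e%:C%C; first by rewrite /= ltcR.
  move=> y /=; rewrite /ball /= modulusE ltcR => xy; apply: eA.
  apply: le_lt_trans xy; rewrite ler_norml.
  have := modulusD (x - y) y; have := modulusD (y - x) x.
  by rewrite !subrK modulus_distC => ? ?; apply/andP; split; lra.
have := continuous_compact (continuous_subspaceT contm) cL.
move=> /compact_bounded[M [_ LM]]; exists (M + 1) => x Lx.
have := LM (M + 1); rewrite ltrDl ltr01 => /(_ isT (modulus x)) /=.
by rewrite ger0_norm ?modulus_ge0 //; apply; exists x.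
Qed.

Theorem theorem4p20 (R : realType) (c : R[i]) (N k : nat) (p : 'I_N -> 'I_k)
    (rho0 : R[i]) :
  superattracting c ->
  (0 < N)%N ->
  (Delta c k [seq (p i : nat) | i <- enum 'I_N]).[rho0] = 0 ->
  (r_bif c <= (modulus rho0)%:E)%E.
Proof.
(* It suffices that no [r] above [modulus rho0] admits a planar minimal set. *)
move=> sc N0 D0; apply: ge_ereal_sup => _ [r [r0 [L [[y Ly] cL invG _]]] <-].
rewrite lee_fin leNgt; apply/negP => rho_r.
have [M LM] := compact_modulus_bounded cL.
have invL : invariant_set c r L.
  by move=> x c' Lx c'r; apply: (invG _ (Gcr_gen c'r)); exists x.
have rpos : 0 < r := le_lt_trans (modulus_ge0 _) rho_r.
have L0 := critical_point_in_invariant_set sc rpos invL LM Ly.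
have [|cs [z [zS zN csE mz]]] := Delta_cycle _ D0.
  by rewrite size_map -cardE card_ord.
rewrite size_map -cardE card_ord -(prednK N0) in zN mz.
by apply: no_neutral_cycle invL LM L0 rho_r _ zS zN mz => i; rewrite csE.
Qed.
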